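(* Let $D$ be a diagram with $N$ crossings of an oriented knot $K\subset S^3$ and let $\rho$ be a parabolic representation of $K$. Then the total-sign $[\epsilon]=\epsilon_1\epsilon_2\cdots\epsilon_N\in\{+1,-1\}$ is constant on the set $\mathcal M^{-1}(\rho)$ of all arc-colorings (with sign-ambiguity) associated to $\rho$; that is, if $a,a'\in\mathcal M^{-1}(\rho)$ have sign-types $\epsilon,\epsilon'$ then $[\epsilon]=[\epsilon']$.
   Context: Diagram conventions: $G_K=\pi_1(S^3\setminus K)$; $D$ is an oriented diagram of $K$ with crossings $c_1,\dots,c_N$ and arcs $\mathsf a_1,\dots,\mathsf a_N$ (an arc is a connected piece of $D$ between two consecutive under-crossings). The Wirtinger generator of $\mathsf a_i$ is $m_i$. At a crossing with incoming under-arc $\mathsf a_i$, outgoing under-arc $\mathsf a_j$, over-arc $\mathsf a_k$, the Wirtinger relation is $m_j=m_k^{-1}m_im_k$ (positive crossing) or $m_j=m_km_im_k^{-1}$ (negative crossing). A parabolic representation is a non-abelian homomorphism $\rho:G_K\to SL_2(\mathbb C)$ with $\mathrm{tr}\,\rho(m)=2$, $\rho(m)\neq I$ for every meridian $m$. For $b=\binom xy\in\mathbb C^2$ let $\mathcal M(b)=\begin{pmatrix}1-xy&x^2\\-y^2&1+xy\end{pmatrix}$; put $a\triangleright b=\mathcal M(b)^{-1}a$, $a\triangleleft b=\mathcal M(b)a$. An arc-coloring (with sign-ambiguity) is $a=(a_1,\dots,a_N)\in(\mathbb C^2)^N$ such that at each crossing $c_n$ (with incoming under-arc $\mathsf a_i$,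 outgoing under-arc $\mathsf a_j$ and over-arc $\mathsf a_k$) $\pm a_j=a_i\triangleright a_k$ if $c_n$ is positive and $\pm a_j=a_i\triangleleft a_k$ if negative, for some choice of sign. $\mathcal M^{-1}(\rho)$ is the set of such $a$ with $\mathcal M(a_i)=\rho(m_i)$ for all $i$. For $a\in\mathcal M^{-1}(\rho)$ all $a_i$ are non-zero, so the sign at each crossing $c_n$ is a uniquely determined $\epsilon_n\in\{\pm1\}$ with $\epsilon_na_j=a_i\triangleright a_k$ (resp. $\epsilon_na_j=a_i\triangleleft a_k$); the tuple $\epsilon=(\epsilon_1,\dots,\epsilon_N)$ is the sign-type of $a$. *)

(* Defs.v *)
From HB Require Import structures.
From mathcomp Require Import all_boot all_order all_fingroup all_algebra.
From mathcomp Require Import generic_quotient complex boolp classical_sets reals.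

Set Implicit Arguments.
Unset Strict Implicit.
Unset Printing Implicit Defensive.

Import GRing.Theory.

Local Open Scope ring_scope.
Local Open Scope complex_scope.
Local Open Scope quotient_scope.

(** * Oriented knot diagrams

    A diagram is recorded by its oriented, signed Gauss code.  Travelling once
    along the oriented diagram, every crossing is passed twice: once along its
    over-strand and once along its under-strand. *)

Definition pass (N : nat) : finType := ('I_N * bool)%type.

Definition over_pass (N : nat) (c : 'I_N) : pass N := (c, true).
Definition under_pass (N : nat) (c : 'I_N) : pass N := (c, false).
Definition is_over (N : nat) (p : pass N) : bool := p.2.

Section Faces.
Variables (N : nat) (next : {perm pass N}) (positive : pred 'I_N).

(* The edges of the underlying 4-valent graph are the segments of the diagram
   from a pass [p] to the pass [next p].  The half-edge [(p, true)] is the end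
   of an edge arriving at [p]; [(p, false)] is the beginning of the edge leaving
   [p]. *)
Definition half_edge : finType := (pass N * bool)%type.

Definition opposite_end (h : half_edge) : half_edge :=
  if h.2 then ((next^-1)%g h.1, false) else (next h.1, true).

(* Next half-edge in counterclockwise order around a crossing.  The
   counterclockwise order is: under-in, over-out, under-out, over-in at a positive
   crossing, and under-in, over-in, under-out, over-out at a negative one. *)
Definition turn (h : half_edge) : half_edge :=
  let: (c, o, i) := h in
  match positive c, o, i with
  | true, false, true => (over_pass c, false)
  | true, true, false => (under_pass c, false)
  | true, false, false => (over_pass c, true)
  | true, true, true => (under_pass c, true)
  | false, false, true => (over_pass c, true)
  | false, true, true => (under_pass c, false)
  | false, false, false => (over_pass c, false)
  | false, true, false => (under_pass c, true)
  end.

(* The orbits of this permutation are the complementary regions of the diagram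
   on the closed oriented surface obtained by thickening it and capping off. *)
Definition face_step (h : half_edge) : half_edge := turn (opposite_end h).

(* [edge_step p q]: the edges leaving [p] and [q] are separated by a single
   over-pass. *)
Definition edge_step : rel (pass N) :=
  [rel p q | (q == next p) && is_over q || (p == next q) && is_over p].

End Faces.

(* [knot_arc p] is the label of the arc containing the edge that leaves [p].
   With N vertices and 2N edges, the equation on the number of faces says that
   the Euler characteristic is 2, i.e. that the diagram lies on the sphere.  It
   forces N > 0: a circle without crossings has no under-crossing to cut it into
   arcs. *)
Record knot_diagram (N : nat) := KnotDiagram {
  next_pass : {perm pass N};
  positive_crossing : pred 'I_N;
  knot_arc : pass N -> 'I_N;
  one_component : forall p q : pass N, q \in porbit next_pass p;
  planar : fcard (face_step next_pass positive_crossing) predT = N.+2;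
  knot_arcP : forall p q : pass N,
    (knot_arc p == knot_arc q) = connect (edge_step next_pass) p q
}.

Section Arcs.
Variables (N : nat) (D : knot_diagram N).

Definition under_in (c : 'I_N) : 'I_N :=
  knot_arc D (((next_pass D)^-1)%g (under_pass c)).
Definition under_out (c : 'I_N) : 'I_N := knot_arc D (under_pass c).
Definition over_arc (c : 'I_N) : 'I_N := knot_arc D (over_pass c).

End Arcs.

(** * The knot group, by its Wirtinger presentation

    [knot_group D] is the quotient of the free monoid on the letters m_i and
    m_i^-1 by the congruence generated by the trivial cancellations and the
    Wirtinger relations.  It is isomorphic to the fundamental group of the
    complement of the knot with diagram [D]. *)

Section KnotGroup.
Variables (N : nat) (D : knot_diagram N).

(* The letter [(i, false)] stands for the generator m_i and [(i, true)] for its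
   inverse. *)
Notation word := (seq ('I_N * bool)).

Definition inv_word (w : word) : word := rev [seq (l.1, ~~ l.2) | l <- w].

Definition wirtinger_word (c : 'I_N) : word :=
  let i := under_in D c in let k := over_arc D c in
  if positive_crossing D c then [:: (k, true); (i, false); (k, false)]
  else [:: (k, false); (i, false); (k, true)].

Inductive word_eq : word -> word -> Prop :=
| word_eq_refl w : word_eq w w
| word_eq_sym v w : word_eq v w -> word_eq w v
| word_eq_trans u v w : word_eq u v -> word_eq v w -> word_eq u w
| word_eq_cat v v' w w' :
    word_eq v v' -> word_eq w w' -> word_eq (v ++ w) (v' ++ w')
| word_eq_cancel i b : word_eq [:: (i, b); (i, ~~ b)] [::]
| word_eq_wirtinger c :
    word_eq [:: (under_out D c, false)] (wirtinger_word c).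

Definition word_eqb : rel word := fun v w => `[< word_eq v w >].

Fact word_eqb_equiv : equiv_class_of word_eqb.
Proof.
split=> [w|v w|v u w].
- by apply/asboolP; apply: word_eq_refl.
- by apply/asbool_equiv_eq; split; apply: word_eq_sym.
- move=> /asboolP uv /asboolP vw; apply/asboolP; exact: word_eq_trans uv vw.
Qed.

Canonical word_equiv := EquivRelPack word_eqb_equiv.

Definition knot_group : Type := {eq_quot word_equiv}.
HB.instance Definition _ := Choice.on knot_group.
HB.instance Definition _ := EqQuotient.on knot_group.

Lemma knot_group_eqP (v w : word) :
  \pi_knot_group v = \pi_knot_group w <-> word_eq v w.
Proof.
split=> [/eqmodP/asboolP //|vw].
by apply/eqmodP/asboolP.
Qed.

Lemma knot_groupW (P : knot_group -> Prop) :
  (forall w : word, P (\pi_knot_group w)) -> forall x, P x.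
Proof. exact: quotW. Qed.

Lemma repr_word_eq (w : word) : word_eq (repr (\pi_knot_group w)) w.
Proof. by apply/knot_group_eqP; rewrite reprK. Qed.

Lemma word_eq_mulV (w : word) : word_eq (w ++ inv_word w) [::].
Proof.
elim: w => [|[i b] w IHw]; first exact: word_eq_refl.
rewrite /inv_word /= rev_cons -cats1 catA.
apply: word_eq_trans (word_eq_cancel i b).
exact: (word_eq_cat (word_eq_refl [:: (i, b)])
  (word_eq_cat IHw (word_eq_refl [:: (i, ~~ b)]))).
Qed.

Lemma inv_wordK : involutive inv_word.
Proof.
move=> w; rewrite /inv_word map_rev revK -map_comp -[RHS]map_id.
by apply: eq_map => -[i b] /=; rewrite negbK.
Qed.

Lemma word_eq_Vmul (w : word) : word_eq (inv_word w ++ w) [::].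
Proof. by rewrite -{2}[w]inv_wordK; apply: word_eq_mulV. Qed.

Lemma word_eq_inv (v w : word) : word_eq v w -> word_eq (inv_word v) (inv_word w).
Proof.
move=> vw; rewrite -[inv_word v]cats0.
apply: word_eq_trans
  (word_eq_cat (word_eq_refl _) (word_eq_sym (word_eq_mulV w))) _.
rewrite catA -[X in word_eq _ X]cat0s; apply: word_eq_cat _ (word_eq_refl _).
apply: word_eq_trans (word_eq_Vmul v).
exact: word_eq_cat (word_eq_refl _) (word_eq_sym vw).
Qed.

Definition knot_group_one : knot_group := \pi_knot_group [::].
Definition knot_group_mul (x y : knot_group) : knot_group :=
  \pi_knot_group (repr x ++ repr y).
Definition knot_group_inv (x : knot_group) : knot_group :=
  \pi_knot_group (inv_word (repr x)).

Lemma knot_group_mul_pi (v w : word) :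
  knot_group_mul (\pi_knot_group v) (\pi_knot_group w) = \pi_knot_group (v ++ w).
Proof. by apply/knot_group_eqP/word_eq_cat; apply: repr_word_eq. Qed.

Lemma knot_group_inv_pi (w : word) :
  knot_group_inv (\pi_knot_group w) = \pi_knot_group (inv_word w).
Proof. by apply/knot_group_eqP/word_eq_inv/repr_word_eq. Qed.

Fact knot_group_mulA : associative knot_group_mul.
Proof.
move=> x y z; elim/knot_groupW: x => u; elim/knot_groupW: y => v; elim/knot_groupW: z => w.
by rewrite !knot_group_mul_pi catA.
Qed.

Fact knot_group_mul1 : left_id knot_group_one knot_group_mul.
Proof. by move=> x; elim/knot_groupW: x => w; rewrite knot_group_mul_pi. Qed.

Fact knot_group_mulr1 : right_id knot_group_one knot_group_mul.
Proof. by move=> x; elim/knot_groupW: x => w; rewrite knot_group_mul_pi cats0. Qed.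

Fact knot_group_mulV : left_inverse knot_group_one knot_group_inv knot_group_mul.
Proof.
move=> x; elim/knot_groupW: x => w; rewrite knot_group_inv_pi knot_group_mul_pi.
exact/knot_group_eqP/word_eq_Vmul.
Qed.

Fact knot_group_mulrV : right_inverse knot_group_one knot_group_inv knot_group_mul.
Proof.
move=> x; elim/knot_groupW: x => w; rewrite knot_group_inv_pi knot_group_mul_pi.
exact/knot_group_eqP/word_eq_mulV.
Qed.

HB.instance Definition _ := isGroup.Build knot_group
  knot_group_mulA knot_group_mul1 knot_group_mulr1
  knot_group_mulV knot_group_mulrV.

Definition wirtinger (i : 'I_N) : knot_group := \pi_knot_group [:: (i, false)].

(* The oriented meridians of a knot form one conjugacy class, which contains all
   the Wirtinger generators. *)
Definition is_meridian (m : knot_group) : Prop :=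
  exists (i : 'I_N) (g : knot_group), m = (wirtinger i ^ g)%g.

End KnotGroup.

(** * SL_2 and parabolic representations *)

Record SL2 (F : fieldType) := MkSL2 {
  SL2val :> 'M[F]_2;
  SL2_det : \det SL2val == 1
}.

Section SL2Group.
Variable F : fieldType.

HB.instance Definition _ := [isSub for @SL2val F].
HB.instance Definition _ := [Choice of SL2 F by <:].

Fact SL2_one_subproof : \det (1%:M : 'M[F]_2) == 1.
Proof. by rewrite det1. Qed.

Fact SL2_mul_subproof (A B : SL2 F) : \det (SL2val A *m SL2val B) == 1.
Proof. by rewrite det_mulmx (eqP (SL2_det A)) (eqP (SL2_det B)) mulr1. Qed.

Fact SL2_inv_subproof (A : SL2 F) : \det (invmx (SL2val A)) == 1.
Proof. by rewrite det_inv (eqP (SL2_det A)) invr1. Qed.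

Definition SL2_one := MkSL2 SL2_one_subproof.
Definition SL2_mul (A B : SL2 F) := MkSL2 (SL2_mul_subproof A B).
Definition SL2_inv (A : SL2 F) := MkSL2 (SL2_inv_subproof A).

Lemma SL2_unit (A : SL2 F) : SL2val A \in unitmx.
Proof. by rewrite unitmxE (eqP (SL2_det A)) unitr1. Qed.

Fact SL2_mulA : associative SL2_mul.
Proof. by move=> A B C; apply: val_inj; rewrite /= mulmxA. Qed.

Fact SL2_mul1 : left_id SL2_one SL2_mul.
Proof. by move=> A; apply: val_inj; rewrite /= mul1mx. Qed.

Fact SL2_mulr1 : right_id SL2_one SL2_mul.
Proof. by move=> A; apply: val_inj; rewrite /= mulmx1. Qed.

Fact SL2_mulV : left_inverse SL2_one SL2_inv SL2_mul.
Proof. by move=> A; apply: val_inj; rewrite /= mulVmx ?SL2_unit. Qed.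

Fact SL2_mulrV : right_inverse SL2_one SL2_inv SL2_mul.
Proof. by move=> A; apply: val_inj; rewrite /= mulmxV ?SL2_unit. Qed.

HB.instance Definition _ := isGroup.Build (SL2 F)
  SL2_mulA SL2_mul1 SL2_mulr1 SL2_mulV SL2_mulrV.

End SL2Group.

Definition parabolic (R : realType) (N : nat) (D : knot_diagram N)
    (rho : {multiplicative knot_group D -> SL2 R[i]}) : Prop :=
  (exists g h, (rho g * rho h <> rho h * rho g)%g) /\
  (forall m, is_meridian m -> \tr (SL2val (rho m)) = 2 /\ rho m <> 1%g).

(** * Arc-colorings *)

Section Colorings.
Variable R : realType.
Notation C := R[i].

Definition Mmap (b : 'cV[C]_2) : 'M[C]_2 :=
  let x := b 0 0 in let y := b 1 0 in
  \matrix_(i, j) (nth [::] [:: [:: 1 - x * y; x ^+ 2];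
                               [:: - y ^+ 2; 1 + x * y]] i)`_j.

(* [quandle_r] and [quandle_l] are the operations written with a right-pointing
   and a left-pointing triangle, respectively. *)
Definition quandle_r (a b : 'cV[C]_2) : 'cV[C]_2 := invmx (Mmap b) *m a.
Definition quandle_l (a b : 'cV[C]_2) : 'cV[C]_2 := Mmap b *m a.

Variables (N : nat) (D : knot_diagram N).

Definition crossing_op (c : 'I_N) : 'cV[C]_2 -> 'cV[C]_2 -> 'cV[C]_2 :=
  if positive_crossing D c then quandle_r else quandle_l.

Definition is_sign (e : int) : Prop := e = 1 \/ e = -1.

Definition crossing_sign (a : 'I_N -> 'cV[C]_2) (c : 'I_N) (e : int) : Prop :=
  is_sign e /\
  a (under_out D c) *~ e = crossing_op c (a (under_in D c)) (a (over_arc D c)).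

Definition arc_coloring (a : 'I_N -> 'cV[C]_2) : Prop :=
  forall c, exists e, crossing_sign a c e.

Definition colorings_of (rho : {multiplicative knot_group D -> SL2 C}) :
    set ('I_N -> 'cV[C]_2) :=
  [set a | arc_coloring a /\
           forall i, Mmap (a i) = SL2val (rho (wirtinger D i))].

Definition sign_type (a : 'I_N -> 'cV[C]_2) (eps : 'I_N -> int) : Prop :=
  forall c, crossing_sign a c (eps c).

Definition total_sign (eps : 'I_N -> int) : int := \prod_(c < N) eps c.

End Colorings.

(* Main.v *)
(** Two arc-colorings of the same representation differ by a sign [s i] on each
    arc [i], so the sign of a crossing changes by the product of the signs of its
    two under-arcs.  In the product over all passes [p] of
    [s (arc before p) * s (arc after p)] every arc sign occurs an even number of
    times, so it is 1; the over-passes contribute 1 to it because the arc does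
    not change there, and hence the under-passes also contribute 1. *)

Require Import Defs.
From mathcomp Require Import all_boot all_order all_fingroup all_algebra.
From mathcomp Require Import complex boolp classical_sets reals.

Local Open Scope ring_scope.
Local Open Scope classical_set_scope.

Import GRing.Theory Num.Theory.

Lemma is_sign_sqr (e : int) : is_sign e -> e * e = 1.
Proof. by case=> ->. Qed.

Lemma MmapE (R : realType) (b : 'cV[complex R]_2) :
  [/\ Mmap b 0 0 = 1 - b 0 0 * b 1 0, Mmap b 0 1 = b 0 0 ^+ 2
    & Mmap b 1 0 = - b 1 0 ^+ 2].
Proof. by rewrite /Mmap !mxE. Qed.

Lemma Mmap0 (R : realType) : Mmap (0 : 'cV[complex R]_2) = 1%:M.
Proof.
apply/matrixP=> -[[|[|//]] lti] [[|[|//]] ltj];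
  by rewrite /Mmap !mxE /= ?mulr0 ?expr0n /= ?subr0 ?addr0 ?oppr0.
Qed.

(** The entries of [Mmap b] determine [x ^+ 2], [y ^+ 2] and [x * y], hence the pair [(x, y)] up to
    one common sign. *)
Lemma Mmap_eq_sign (R : realType) (b b' : 'cV[complex R]_2) :
  Mmap b = Mmap b' -> b' = b \/ b' = - b.
Proof.
move=> eqM.
have [E1 E2 E3] := MmapE R b; have [E1' E2' E3'] := MmapE R b'.
move: E1 E2 E3; rewrite eqM E1' E2' E3'.
move=> /addrI/oppr_inj Exy Exx /oppr_inj Eyy.
have colP2 (u v : 'cV[complex R]_2) :
  u 0 0 = v 0 0 -> u 1 0 = v 1 0 -> u = v.
  move=> e0 e1; apply/colP=> -[[|[|//]] lti].
  - by rewrite (_ : Ordinal lti = 0) //; apply: val_inj.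
  - by rewrite (_ : Ordinal lti = 1) //; apply: val_inj.
(* If [x = 0], the sign is read off from [y ^+ 2]; otherwise [x ^+ 2] fixes it, and cancelling [x]
   in [x * y] forces the same sign on [y]. *)
have [x0|xN0] := eqVneq (b 0 0) 0.
  have x'0 : b' 0 0 = 0 by apply/eqP; rewrite -sqrf_eq0 Exx x0 expr0n.
  move/eqP: Eyy; rewrite eqf_sqr => /orP[]/eqP Ey; [left|right]; apply: colP2;
    by rewrite ?mxE ?x0 ?x'0 ?oppr0.
move/eqP: (Exx); rewrite eqf_sqr => /orP[]/eqP Ex; [left|right];
  apply: colP2; rewrite ?mxE //.
- by apply: (mulfI xN0); rewrite -Exy Ex.
- by apply: (mulfI xN0); rewrite mulrN -Exy Ex mulNr opprK.
Qed.

Lemma mulrz_sign_inj (R : realType) (v : 'cV[complex R]_2) (e f : int) :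
  v != 0 -> v *~ e = v *~ f -> e = f.
Proof.
move=> vN0 /eqP; rewrite -subr_eq0 -mulrzBr -scaler_int scaler_eq0 (negPf vN0).
by rewrite orbF intr_eq0 subr_eq0 => /eqP.
Qed.

Section Colorings.

Context {R : realType} {N : nat} (D : knot_diagram N).

(** Both operations are linear in the first argument and see the second only through [Mmap], so a
    sign change on the over-arc has no effect. *)
Lemma crossing_op_sign (c : 'I_N) (a b b' : 'cV[complex R]_2) (e : int) :
  Mmap b = Mmap b' ->
  crossing_op D c (a *~ e) b' = crossing_op D c a b *~ e.
Proof.
rewrite /crossing_op => eqM.
by case: ifP => _; rewrite /quandle_r /quandle_l eqM raddfMz.
Qed.

(** A zero color would send the meridian [wirtinger D i] to the identity. Non-vanishing lets signs
    be cancelled from equations between colors. *)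
Lemma coloring_neq0 (rho : {multiplicative knot_group D -> SL2 (complex R)})
    (a : 'I_N -> 'cV[complex R]_2) (i : 'I_N) :
  parabolic rho -> colorings_of rho a -> a i != 0.
Proof.
move=> [_ par] [_ aM]; apply/eqP => ai0.
have mer : is_meridian (wirtinger D i).
  by exists i, 1%g; rewrite conjg1.
have [_] := par _ mer; apply; apply: val_inj => /=.
by rewrite -aM ai0 Mmap0.
Qed.

Lemma knot_arc_over (c : 'I_N) :
  knot_arc D ((next_pass D)^-1 (over_pass c))%g = over_arc D c.
Proof.
apply/eqP; rewrite knot_arcP; apply: connect1.
by rewrite /edge_step /= permKV eqxx.
Qed.

Lemma prod_under_arcs (s : 'I_N -> int) :
  (forall i, is_sign (s i)) ->
  \prod_c (s (under_in D c) * s (under_out D c)) = 1.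
Proof.
move=> s_sign.
(* Stepping back by one pass permutes the passes. *)
have prev_arc : \prod_p s (knot_arc D (((next_pass D)^-1)%g p)) =
                \prod_p s (knot_arc D p).
  by rewrite [RHS](reindex_inj (@perm_inj _ (next_pass D)^-1)%g).
pose t p := s (knot_arc D (((next_pass D)^-1)%g p)) * s (knot_arc D p).
transitivity (\prod_(p : pass N) t p); last first.
  rewrite big_split /= prev_arc -big_split big1 //= => p _.
  exact: is_sign_sqr.
transitivity (\prod_(c < N) \prod_(o : bool) t (c, o)); last first.
  by rewrite pair_bigA; apply: eq_bigr => -[].
apply: eq_bigr => c _; rewrite big_bool /t.
rewrite /= [knot_arc D (_ (c, true))]knot_arc_over.
by rewrite (is_sign_sqr _ (s_sign (over_arc D c))) mul1r.
Qed.

End Colorings.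

Theorem proposition3p5 (R : realType) (N : nat) (D : knot_diagram N)
    (rho : {multiplicative knot_group D -> SL2 (complex R)})
    (hrho : parabolic rho)
    (a a' : 'I_N -> 'cV[complex R]_2)
    (ha : colorings_of rho a) (ha' : colorings_of rho a')
    (eps eps' : 'I_N -> int)
    (heps : sign_type D a eps) (heps' : sign_type D a' eps') :
  total_sign eps = total_sign eps'.
Proof.
have eqM i : Mmap (a i) = Mmap (a' i) by rewrite (proj2 ha) (proj2 ha').
pose s i : int := if a' i == a i then 1 else -1.
have s_sign i : is_sign (s i) by rewrite /s; case: ifP => _; [left|right].
have a'E i : a' i = a i *~ s i.
  rewrite /s; case: eqVneq => [-> //|/eqP ne].
  by rewrite mulrN1z; case: (Mmap_eq_sign _ _ _ (eqM i)).
have epsE c : eps' c * (s (under_in D c) * s (under_out D c)) = eps c.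
  have [_ e] := heps c; have [_ e'] := heps' c.
  move: e'; rewrite (a'E (under_out D c)) (a'E (under_in D c)).
  rewrite (crossing_op_sign _ _ _ _ _ _ (eqM _)) -e -!mulrzA.
  (* Comparing multiples of the non-zero color [a (under_out D c)] gives [s (under_out D c) * eps' c
     = eps c * s (under_in D c)]. *)
  move=> /(mulrz_sign_inj _ _ _ _ (coloring_neq0 _ _ _ _ hrho ha)) es.
  by rewrite mulrCA [eps' c * _]mulrC es mulrCA is_sign_sqr ?mulr1.
rewrite /total_sign -(eq_bigr _ (fun c _ => epsE c)) big_split /=.
by rewrite prod_under_arcs // mulr1.
Qed.
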